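(* Let $b \geq 2$ be an integer. There exists a constant $C_b > 0$, depending only on $b$, such that for every integer $n > e$ (i.e., $n \geq 3$), \[ s_b(n!) > C_b \log n \,\log\log\log n \quad\text{and}\quad s_b(\Lambda_n) > C_b \log n \,\log\log\log n . \]
   Context: For an integer $b \geq 2$ and a positive integer $m$, $s_b(m)$ denotes the sum of the digits of $m$ when written in base $b$. For a positive integer $n$, $\Lambda_n := \operatorname{lcm}(1,2,\ldots,n)$ is the least common multiple of $1,2,\ldots,n$. $\log$ is the natural logarithm. *)

(* Defs.v *)
From Stdlib Require Import Reals Arith Lia.

(* Sum of base-b digits of m (for b >= 2). Fuel m suffices since m/b < m. *)
Fixpoint digsum_aux (fuel b m : nat) : nat :=
  match fuel with
  | O => 0
  | S f => match m with
           | O => 0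
           | _ => m mod b + digsum_aux f b (m / b)
           end
  end.

Definition digit_sum (b m : nat) : nat := digsum_aux m b m.

Fixpoint lcm_upto (n : nat) : nat :=
  match n with
  | O => 1
  | S k => Nat.lcm (S k) (lcm_upto k)
  end.

(* Main.v *)
(** Every positive multiple of b^k - 1 has base-b digit sum at least k, so it suffices to find
    k of order log n logloglog n with b^k - 1 dividing lcm(1..n), i.e. such that every prime
    power p^a dividing b^k - 1 is at most n.  If d is the order of b modulo p, the p-part of
    b^d - 1 divides Phi_d(b) <= (b+1)^phi(d), and lifting the exponent costs at most a further
    factor k; hence p^a <= (b+1)^(phi(k)+2) k.  Taking k a multiple of y! gives
    phi(k) <= k / (1 + 1/2 + ... + 1/y) <= k / log y, and with y! about log n, so that log y is
    about logloglog n, one can take k of order log n logloglog n while keeping phi(k) below a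
    small multiple of log n. *)

Require Import Defs.
From Stdlib Require Import Reals Arith Lia Lra.
From mathcomp Require all_boot all_order all_algebra all_field cyclic zify.

(** * Digit sums in base b *)

Lemma digsum_aux_fuel (b f g m : nat) : (2 <= b)%nat -> (m <= f)%nat -> (m <= g)%nat ->
  digsum_aux f b m = digsum_aux g b m.
Proof.
  intros hb. revert g m. induction f as [|f IH]; intros g m hf hg.
  - replace m with 0%nat by lia. now destruct g.
  - destruct g as [|g]; [now replace m with 0%nat by lia|].
    destruct m as [|m]; [reflexivity|].
    cbn [digsum_aux]. f_equal.
    assert (S m / b < S m)%nat by (apply Nat.div_lt; lia).
    apply IH; lia.
Qed.

Lemma digit_sum_step (b m : nat) : (2 <= b)%nat ->
  digit_sum b m = (m mod b + digit_sum b (m / b))%nat.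
Proof.
  intros hb. destruct m as [|m].
  - rewrite Nat.Div0.mod_0_l, Nat.Div0.div_0_l. reflexivity.
  - unfold digit_sum at 1. cbn [digsum_aux]. f_equal.
    assert (S m / b < S m)%nat by (apply Nat.div_lt; lia).
    apply digsum_aux_fuel; lia.
Qed.

Lemma digit_sum_mul_add (b q r : nat) : (2 <= b)%nat -> (r < b)%nat ->
  digit_sum b (b * q + r) = (digit_sum b q + r)%nat.
Proof.
  intros hb hr. rewrite digit_sum_step by lia.
  rewrite <- (Nat.mod_unique (b * q + r) b q r), <- (Nat.div_unique (b * q + r) b q r) by lia.
  lia.
Qed.

(** Without a carry the last digit grows by one; with a carry the last digit b - 1 becomes 0 and the
    claim passes to the quotient. *)
Lemma digit_sum_succ_le (b m : nat) : (2 <= b)%nat -> (digit_sum b (S m) <= S (digit_sum b m))%nat.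
Proof.
  intros hb. induction m as [m IH] using lt_wf_ind.
  pose proof (Nat.div_mod_eq m b) as E.
  pose proof (Nat.mod_upper_bound m b ltac:(lia)) as hr.
  assert (hqm : m <> 0%nat -> (m / b < m)%nat) by (intros; apply Nat.div_lt; lia).
  set (q := (m / b)%nat) in *. set (r := (m mod b)%nat) in *.
  assert (dm : digit_sum b m = (digit_sum b q + r)%nat)
    by (rewrite E; apply digit_sum_mul_add; lia).
  destruct (Nat.eq_dec (S r) b) as [hrb|hrb].
  - replace (S m) with (b * S q + 0)%nat by nia.
    rewrite digit_sum_mul_add by lia.
    assert (hm : m <> 0%nat) by nia.
    specialize (IH q (hqm hm)). lia.
  - replace (S m) with (b * q + S r)%nat by lia.
    rewrite digit_sum_mul_add by lia. lia.
Qed.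

(** A carry trades b units in one position for a single unit in the next, so it can only lower the
    total. *)
Lemma digit_sum_add_le (b m n : nat) : (2 <= b)%nat ->
  (digit_sum b (m + n) <= digit_sum b m + digit_sum b n)%nat.
Proof.
  intros hb. revert n. induction m as [m IH] using lt_wf_ind. intros n.
  destruct (Nat.eq_dec m 0) as [->|hm]; [exact (Nat.le_refl _)|].
  pose proof (Nat.div_mod_eq m b) as Em. pose proof (Nat.div_mod_eq n b) as En.
  pose proof (Nat.mod_upper_bound m b ltac:(lia)) as hr.
  pose proof (Nat.mod_upper_bound n b ltac:(lia)) as hs.
  assert (hqm : (m / b < m)%nat) by (apply Nat.div_lt; lia).
  set (q := (m / b)%nat) in *. set (r := (m mod b)%nat) in *.
  set (u := (n / b)%nat) in *. set (s := (n mod b)%nat) in *.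
  assert (dm : digit_sum b m = (digit_sum b q + r)%nat)
    by (rewrite Em; apply digit_sum_mul_add; lia).
  assert (dn : digit_sum b n = (digit_sum b u + s)%nat)
    by (rewrite En; apply digit_sum_mul_add; lia).
  specialize (IH q hqm u).
  destruct (Nat.lt_ge_cases (r + s) b) as [h|h].
  - replace (m + n)%nat with (b * (q + u) + (r + s))%nat by nia.
    rewrite digit_sum_mul_add by lia. lia.
  - replace (m + n)%nat with (b * S (q + u) + (r + s - b))%nat by nia.
    rewrite digit_sum_mul_add by lia.
    pose proof (digit_sum_succ_le b (q + u) hb). lia.
Qed.

(** The digits of r fill the k low positions and those of q lie above them, so no carry occurs. *)
Lemma digit_sum_mul_pow_add (b k q r : nat) : (2 <= b)%nat -> (r < b ^ k)%nat ->
  digit_sum b (q * b ^ k + r) = (digit_sum b q + digit_sum b r)%nat.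
Proof.
  intros hb. revert r. induction k as [|k IH]; intros r hr.
  - rewrite Nat.pow_0_r in *. replace r with 0%nat by lia.
    rewrite Nat.mul_1_r, !Nat.add_0_r. reflexivity.
  - rewrite Nat.pow_succ_r' in *.
    pose proof (Nat.div_mod_eq r b) as Er.
    pose proof (Nat.mod_upper_bound r b ltac:(lia)) as hmod.
    assert (hdiv : (r / b < b ^ k)%nat) by (apply Nat.Div0.div_lt_upper_bound; lia).
    replace (q * (b * b ^ k) + r)%nat with (b * (q * b ^ k + r / b) + r mod b)%nat by nia.
    rewrite digit_sum_mul_add, IH, (digit_sum_step b r) by lia. lia.
Qed.

(** The number consists of k digits, all equal to b - 1 >= 1. *)
Lemma digit_sum_pred_pow (b k : nat) : (2 <= b)%nat -> (k <= digit_sum b (b ^ k - 1))%nat.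
Proof.
  intros hb. induction k as [|k IH]; [lia|].
  assert (b ^ k <> 0)%nat by (apply Nat.pow_nonzero; lia).
  rewrite Nat.pow_succ_r'.
  replace (b * b ^ k - 1)%nat with (b * (b ^ k - 1) + (b - 1))%nat by nia.
  rewrite digit_sum_mul_add; lia.
Qed.

(* Folding m = q b^k + r into q + r preserves divisibility by b^k - 1 and does not
   increase the digit sum; iterating, one reaches b^k - 1 itself. *)
Lemma digit_sum_ge_of_dvd (b k m : nat) : (2 <= b)%nat -> (0 < m)%nat ->
  Nat.divide (b ^ k - 1) m -> (k <= digit_sum b m)%nat.
Proof.
  intros hb. induction m as [m IH] using lt_wf_ind. intros hm [c hc].
  destruct k as [|k']; [lia|]. set (k := S k') in *.
  assert (hB : (2 <= b ^ k)%nat).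
  { apply Nat.le_trans with (b ^ 1)%nat; [cbn; lia|]. apply Nat.pow_le_mono_r; unfold k; lia. }
  destruct (Nat.eq_dec m (b ^ k - 1)) as [->|hne]; [now apply digit_sum_pred_pow|].
  pose proof (Nat.div_mod_eq m (b ^ k)) as E.
  pose proof (Nat.mod_upper_bound m (b ^ k) ltac:(lia)) as hr.
  set (q := (m / b ^ k)%nat) in *. set (r := (m mod b ^ k)%nat) in *.
  set (B := (b ^ k)%nat) in *.
  (* Below b^k the only positive multiple of b^k - 1 is b^k - 1 itself, which is already
     excluded. *)
  assert (hq : (0 < q)%nat).
  { apply Nat.neq_0_lt_0. intros hq. rewrite hq in E.
    destruct c as [|[|c]]; [lia|lia|nia]. }
  (* From q b^k + r = q (b^k - 1) + (q + r): the folded number is c - q times b^k - 1. *)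
  assert (hqc : (c * (B - 1) = (B - 1) * q + (q + r))%nat) by nia.
  assert (hdiv : Nat.divide (b ^ k - 1) (q + r)) by (exists (c - q)%nat; rewrite Nat.mul_sub_distr_r; lia).
  specialize (IH (q + r)%nat ltac:(nia) ltac:(lia) hdiv).
  pose proof (digit_sum_add_le b q r hb).
  rewrite E, (Nat.mul_comm B). unfold B in *. rewrite digit_sum_mul_pow_add by assumption. lia.
Qed.

(** * Divisibility properties of lcm(1..n) *)

Lemma divide_lcm_upto (j n : nat) : (1 <= j <= n)%nat -> Nat.divide j (lcm_upto n).
Proof.
  induction n as [|n IH]; intros hj; [lia|]. cbn [lcm_upto].
  destruct (Nat.eq_dec j (S n)) as [->|hne]; [apply Nat.divide_lcm_l|].
  apply Nat.divide_trans with (lcm_upto n); [apply IH; lia|apply Nat.divide_lcm_r].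
Qed.

Lemma lcm_upto_pos (n : nat) : (0 < lcm_upto n)%nat.
Proof.
  induction n as [|n IH]; cbn [lcm_upto]; [lia|].
  assert (Nat.lcm (S n) (lcm_upto n) <> 0)%nat by (rewrite Nat.lcm_eq_0; lia). lia.
Qed.

Lemma lcm_upto_divide_fact (n : nat) : Nat.divide (lcm_upto n) (fact n).
Proof.
  induction n as [|n IH]; [apply Nat.divide_refl|]. cbn [lcm_upto].
  change (fact (S n)) with (S n * fact n)%nat. apply Nat.lcm_least.
  - apply Nat.divide_factor_l.
  - now apply Nat.divide_mul_r.
Qed.

(* y! (1 + 1/2 + ... + 1/y) *)
Fixpoint fact_harmonic (y : nat) : nat :=
  match y with
  | O => 0
  | S y' => S y' * fact_harmonic y' + fact y'
  end.

Module Smooth.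

Import all_boot all_order all_algebra all_field cyclic zify.
Import GRing.Theory Num.Theory.
Set Implicit Arguments. Unset Strict Implicit. Unset Printing Implicit Defensive.

(** * Inequalities for Euler's totient *)

(** Being coprime to mn forces being coprime to n, and each of the m blocks of n consecutive
    integers below mn has phi(n) such numbers. *)
Lemma leq_totient_mull (m n : nat) : totient (m * n) <= m * totient n.
Proof.
rewrite !totient_count_coprime; apply: (@leq_trans (\sum_(0 <= d < m * n) coprime n d)).
  by apply: leq_sum => d _; rewrite coprimeMl; case: (coprime m d).
elim: m => [|m IHm]; first by rewrite !mul0n big_nil.
rewrite mulSn (@big_cat_nat _ _ _ n) ?leq_addr //= mulSn leq_add2l.
rewrite -{1}[n]add0n big_addn addKn; apply: leq_trans IHm.
by apply: eq_leq; apply: eq_bigr => d _; rewrite /coprime gcdnDr.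
Qed.

(** The cofactor is absorbed one prime p at a time; phi(d) <= phi(p d) only involves the p-part of
    d. *)
Lemma dvdn_leq_totient (d n : nat) : 0 < n -> d %| n -> totient d <= totient n.
Proof.
move=> n_gt0 /dvdnP[m def_n]; rewrite {}def_n in n_gt0 *.
elim/ltn_ind: m d n_gt0 => m IHm d; rewrite muln_gt0 => /andP[m_gt0 d_gt0].
have [m_gt1|] := ltnP 1 m; last by rewrite leq_eqVlt ltnNge m_gt0 orbF => /eqP->; rewrite mul1n.
have p_pr := pdiv_prime m_gt1; set p := pdiv m in p_pr.
have /dvdnP[m' def_m]: p %| m by exact: pdiv_dvd.
have m'_gt0 : 0 < m' by move: m_gt0; rewrite def_m; case: (m').
have p_gt1 := prime_gt1 p_pr; have p_gt0 := ltnW p_gt1.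
have lt_m'm : m' < m by rewrite def_m ltn_Pmulr.
have pd_gt0 : 0 < m' * (p * d) by rewrite !muln_gt0 m'_gt0 p_gt0.
rewrite def_m -mulnA; apply: leq_trans (IHm m' lt_m'm _ pd_gt0).
have [d' co_pd' ->] := pfactor_coprime p_pr d_gt0.
have co (e : nat) : coprime d' (p ^ e) by rewrite coprime_sym coprimeXl.
rewrite [_ * (d' * _)]mulnCA -expnS !totient_coprime // leq_mul2l; apply/orP; right.
case: (logn p d) => [|e]; first by rewrite totient_gt0 expn1.
by rewrite !totient_pfactor //= leq_mul2l expnS leq_pmull ?orbT.
Qed.

(** * Prime powers dividing b^k - 1 *)

(* Lifting the exponent; 4 %| x.-1 is what the argument needs at p = 2, where p need not divide 'C(p, 2). *)
Lemma pfactor_lift (x m : nat) (p : nat) : prime p -> 1 < x -> 0 < m ->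
  p %| x.-1 -> (p = 2 -> 4 %| x.-1) ->
  logn p (x ^ m).-1 = logn p x.-1 + logn p m.
Proof.
move=> p_pr; have p_gt1 := prime_gt1 p_pr.
elim/ltn_ind: m x => m IHm x x_gt1 m_gt0 dvd_p dvd_4.
have dvd_pX (e : nat) (q : nat) : q %| x.-1 -> q %| (x ^ e).-1.
  by rewrite predn_exp; exact: dvdn_mulr.
have [u def_x] : exists u, x = 1 + p * u.
  by case/dvdnP: dvd_p => u def_u; exists u; lia.
have geom_gt0 (e : nat) : 0 < e -> 0 < \sum_(i < e) x ^ i.
  by case: e => // e _; rewrite big_ord_recl expn0.
have logn_geom (e : nat) : 0 < e -> logn p (x ^ e).-1 = logn p x.-1 + logn p (\sum_(i < e) x ^ i).
  by move=> e_gt0; rewrite predn_exp lognM ?geom_gt0 //; lia.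
(* If p does not divide m, the geometric sum is m modulo p, hence prime to p. Otherwise m = m' p,
   and induction applies to x^p with exponent m'. *)
have [/dvdnP[m' def_m] | ndvd_pm] := boolP (p %| m); last first.
  have co_pm : coprime p m by rewrite prime_coprime.
  rewrite logn_geom // (logn_coprime co_pm) (@logn_coprime p (\sum_(i < m) x ^ i)) // prime_coprime //.
  suff: \sum_(i < m) x ^ i = m %[mod p] by move=> E; rewrite /dvdn E.
  elim: m {IHm m_gt0 ndvd_pm co_pm} => [|m IHm]; first by rewrite big_ord0.
  rewrite big_ord_recr /= -modnDm {}IHm -modnXm.
  have -> : x = 1 %[mod p] by rewrite def_x addnC mulnC modnMDl.
  rewrite modnXm exp1n.
  by rewrite modnDm addn1.
have m'_gt0 : 0 < m' by lia.
rewrite {1}def_m mulnC expnM IHm //; first last.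
- by move=> p2; apply: dvd_pX; apply: dvd_4.
- exact: dvd_pX.
- by rewrite -(exp1n p) ltn_exp2r ?prime_gt0.
- by rewrite def_m ltn_Pmulr.
have p_gt0 := ltnW p_gt1; rewrite logn_geom // def_m (lognM p m'_gt0 p_gt0) (logn_prime p p_pr) eqxx.
rewrite -addnA; congr (_ + _); rewrite addnC; congr (_ + _).
(* With x = 1 + pu, x^i is 1 + ipu modulo p^2, so the sum is p + C(p,2) p u. The last term vanishes
   modulo p^2, and the sum has p-adic valuation exactly 1. *)
have sum_mod : \sum_(i < p) x ^ i = p %[mod p ^ 2].
  have pow_mod (i : nat) : x ^ i = 1 + i * (p * u) %[mod p ^ 2].
    elim: i => [|i IHi]; first by rewrite expn0 mul0n.
    rewrite expnS -modnMmr {}IHi modnMmr def_x.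
    have -> : (1 + p * u) * (1 + i * (p * u)) = i * u * u * p ^ 2 + (1 + i.+1 * (p * u)) by nia.
    by rewrite modnMDl.
  have -> : \sum_(i < p) x ^ i = \sum_(i < p) (1 + i * (p * u)) %[mod p ^ 2].
    rewrite -[LHS]modn_summ -[RHS]modn_summ; congr (_ %% _).
    by apply: eq_bigr => i _; apply: pow_mod.
  rewrite big_split /= sum1_card card_ord -big_distrl /= -(big_mkord predT id) bin2_sum.
  suff /dvdnP[w ->] : p ^ 2 %| 'C(p, 2) * (p * u) by rewrite addnC modnMDl.
  case: (ltngtP p 2) => [|p_gt2|p2]; first by lia.
    rewrite -mulnn mulnA dvdn_mulr // dvdn_mul // prime_dvd_bin // p_gt2.
  by move: (dvd_4 p2); rewrite def_x p2 add1n /= binn mul1n.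
have [c def_c] : exists c, \sum_(i < p) x ^ i = p * (1 + p * c).
  have E := divn_eq (\sum_(i < p) x ^ i) (p ^ 2).
  have lt_pp2 : p < p ^ 2 by rewrite -{1}(expn1 p) ltn_exp2l.
  rewrite sum_mod modn_small // in E; exists ((\sum_(i < p) x ^ i) %/ p ^ 2).
  by rewrite [LHS]E; set q := _ %/ _; rewrite -mulnn; nia.
rewrite def_c lognM ?p_gt0 // (logn_prime p p_pr) eqxx (@logn_coprime p (1 + _)) //.
by rewrite /coprime addnC mulnC gcdnMDl gcdn1.
Qed.

(** Over the complex algebraic numbers the value is a product of phi(d) factors b - z^i with z^i on
    the unit circle, each of modulus at most b + 1. *)
Lemma Cyclotomic_horner_le (b d : nat) : 0 < d ->
  (absz ('Phi_d).[b%:Z]%R <= b.+1 ^ totient d)%N.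
Proof.
move=> d_gt0; have [z prim_z] := C_prim_root_exists d_gt0.
have z1 : `|z|%R = 1%R :> algC.
  apply/eqP; rewrite -(@pexpr_eq1 _ _ d) -?normrX ?normr_ge0 //.
  by rewrite (prim_expr_order prim_z) normr1.
rewrite -(ler_nat algC) -[(absz _)%:R%R]/((absz _)%:Z%:~R)%R abszE intr_norm.
rewrite -horner_map (Cintr_Cyclotomic prim_z) /cyclotomic horner_prod normr_prod.
have -> : totient d = #|[pred i : 'I_d | coprime i d]|.
  rewrite totient_count_coprime big_mkord -sum1_card [RHS]big_mkcond /=.
  by apply: eq_bigr => i _; rewrite inE /= coprime_sym; case: coprime.
rewrite natrX -prodr_const; apply: ler_prod => i _; rewrite normr_ge0 !hornerE /=.
apply: Order.POrderTheory.le_trans (ler_normB _ _) _; rewrite normrX z1 expr1n.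
by rewrite -pmulrn normr_nat mulrSr.
Qed.

Lemma Cyclotomic_horner_prod (b d : nat) : 0 < d -> 0 < b ->
  (\prod_(e <- divisors d) ('Phi_e).[b%:Z] = ((b ^ d).-1)%:Z)%R.
Proof.
move=> d_gt0 b_gt0; rewrite -horner_prod prod_Cyclotomic // !hornerE.
rewrite -subn1 -subzn ?expn_gt0 ?b_gt0 //. by rewrite -[X in _ = (X - _)%R]natz natrX natz.
Qed.

(* p^v divides b^d - 1 = \prod_(e | d) Phi_e(b), and p divides none of the Phi_e(b) with e < d. *)
Lemma pfactor_order_le (p b d : nat) : prime p -> 1 < b -> 0 < d ->
  (forall e, 0 < e -> e < d -> ~~ (p %| (b ^ e).-1)) ->
  p ^ logn p (b ^ d).-1 <= b.+1 ^ totient d.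
Proof.
move=> p_pr b_gt1 d_gt0 min_d; have b_gt0 := ltnW b_gt1.
apply: leq_trans (Cyclotomic_horner_le b d_gt0).
have bd_gt0 : 0 < (b ^ d).-1 by rewrite -subn1 subn_gt0 -(exp1n d) ltn_exp2r.
have d_in : d \in divisors d by rewrite -dvdn_divisors.
have := Cyclotomic_horner_prod d_gt0 b_gt0; rewrite (big_rem d) //=.
set Q := (\prod_(_ <- _) _)%R => prodE.
have absE : absz ('Phi_d).[b%:Z]%R * absz Q = (b ^ d).-1 by rewrite -abszM prodE.
have Phi_gt0 : 0 < absz ('Phi_d).[b%:Z]%R by move: bd_gt0; rewrite -absE muln_gt0 => /andP[].
(* By Gauss it is enough that p is coprime to [Q], the product of the Phi_e(b) over the proper
   divisors e of d. *)
apply: dvdn_leq => //; rewrite -(@Gauss_dvdl _ _ (absz Q)) ?absE ?pfactor_dvdnn //.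
apply: coprimeXl; rewrite /Q (big_morph absz abszM (erefl : absz 1%R = 1)).
rewrite big_seq; apply: (big_ind (coprime p)) => [|x y|e]; first exact: coprimen1.
  by rewrite coprimeMr => -> ->.
rewrite mem_rem_uniq ?divisors_uniq // inE -dvdn_divisors // => /andP[e'd dvd_ed].
have e_gt0 : 0 < e := dvdn_gt0 d_gt0 dvd_ed.
have e_in : e \in divisors e by rewrite -dvdn_divisors.
(* Phi_e(b) divides b^e - 1, which p does not divide since e < d. *)
rewrite prime_coprime //; apply: contra (min_d e e_gt0 _); last first.
  by rewrite ltn_neqAle e'd dvdn_leq.
move/dvdn_trans; apply; have := Cyclotomic_horner_prod e_gt0 b_gt0.
rewrite (big_rem e) //= => /(congr1 absz); rewrite abszM absz_nat => <-.
exact: dvdn_mulr.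
Qed.

(** For odd p, write k = d m with d the order of b modulo p: the factor is at most (b+1)^phi(d) from
    b^d - 1 times m from lifting. For p = 2, lifting starts from b^2, since 4 divides b^2 - 1 for
    odd b; the bound b^2 - 1 <= (b+1)^2 accounts for the + 2. *)
Lemma pfactor_pred_exp_le (p b k : nat) : prime p -> 1 < b -> 0 < k ->
  p ^ logn p (b ^ k).-1 <= b.+1 ^ (totient k + 2) * k.
Proof.
move=> p_pr b_gt1 k_gt0; have p_gt0 := prime_gt0 p_pr.
have [dvd_p | ndvd_p] := boolP (p %| (b ^ k).-1); last first.
  by rewrite logn_coprime ?prime_coprime // muln_gt0 expn_gt0 k_gt0.
have pk_le (m : nat) : 0 < m -> p ^ logn p m <= m.
  by move=> m_gt0; apply: dvdn_leq => //; apply: pfactor_dvdnn.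
have bX_gt1 (e : nat) : 0 < e -> 1 < b ^ e by move=> e_gt0; rewrite -(exp1n e) ltn_exp2r.
have bX_gt0 (e : nat) : 0 < e -> 0 < (b ^ e).-1 by move/bX_gt1; case: (b ^ e) => [|[]].
have [p2 | p_neq2] := eqVneq p 2.
  have dvd_4 : 4 %| (b ^ 2).-1.
    have [c def_b] : exists c, b = c.*2.+1.
      exists b./2; rewrite -[LHS]odd_double_half -[RHS]add1n; congr (_ + _).
      apply/eqP; rewrite eqb1; apply: contraLR dvd_p => even_b.
      have bk_gt0 : 0 < b ^ k by rewrite expn_gt0 (ltnW b_gt1).
      rewrite p2 dvdn2 negbK; have := oddX b k.
      by rewrite (negbTE even_b) orbF (gtn_eqF k_gt0) -{1}(prednK bk_gt0) oddS => /negbFE.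
    by apply/dvdnP; exists (c * c + c); rewrite def_b -mulnn; nia.
  have dvd_sq : (b ^ k).-1 %| ((b ^ 2) ^ k).-1.
    by rewrite -expnM mulnC expnM (predn_exp _ 2) dvdn_mulr.
  apply: leq_trans (leq_pexp2l p_gt0 (dvdn_leq_log p _ dvd_sq)) _.
    by rewrite -expnM bX_gt0 // muln_gt0.
  rewrite pfactor_lift ?bX_gt1 //; last by rewrite p2 (dvdn_trans _ dvd_4).
  rewrite expnD leq_mul ?pk_le // (leq_trans (pk_le _ _)) ?bX_gt0 //.
  rewrite (leq_trans (leq_pred _)) // (@leq_trans (b.+1 ^ 2)) ?leq_exp2r //.
  by rewrite leq_pexp2l ?leq_addl.
have ex_d : exists d, (0 < d) && (p %| (b ^ d).-1) by exists k; rewrite k_gt0.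
case: (ex_minnP ex_d) => d /andP[d_gt0 dvd_d] min_d.
(* Otherwise k mod d would be a smaller positive exponent e with p dividing b^e - 1. *)
have dvd_dk : d %| k.
  have [//|r_gt0] := posnP (k %% d); first by move/eqP.
  have := min_d (k %% d); rewrite r_gt0 leqNgt ltn_mod d_gt0 /= => F.
  suff: p %| (b ^ (k %% d)).-1 by move/F.
  move: dvd_p dvd_d; rewrite -!subn1 -!eqn_mod_dvd ?expn_gt0 ?(ltnW b_gt1) //.
  move=> /eqP bk1 /eqP bd1; apply/eqP; rewrite -bk1 [in RHS](divn_eq k d) expnD (mulnC _ d) expnM.
  by rewrite -[RHS]modnMml -[in RHS]modnXm bd1 modnXm exp1n modnMml mul1n.
have [m def_k] := dvdnP dvd_dk; have m_gt0 : 0 < m by move: k_gt0; rewrite def_k muln_gt0 => /andP[].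
rewrite {1}def_k mulnC expnM pfactor_lift ?bX_gt1 //; last by move=> p2; rewrite p2 eqxx in p_neq2.
rewrite expnD leq_mul //.
  apply: leq_trans (_ : b.+1 ^ totient d <= _).
    apply: pfactor_order_le => // e e_gt0 lt_ed; apply/negP => dvd_e.
    by have := min_d e; rewrite e_gt0 dvd_e leqNgt lt_ed => /(_ isT).
  by rewrite leq_pexp2l // (leq_trans (dvdn_leq_totient k_gt0 dvd_dk)) ?leq_addr.
by rewrite (leq_trans (pk_le m m_gt0)) // def_k leq_pmulr.
Qed.

(** * Choice of the exponent k *)

(** Gauss's identity for the sum of phi over divisors, reindexed by the involution d -> k / d. *)
Lemma sum_totient_codvd (k : nat) : 0 < k ->
  \sum_(d < k.+1 | d %| k) totient (k %/ d) = k.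
Proof.
move=> k_gt0; rewrite -[RHS]sum_totient_dvd.
pose h (d : 'I_k.+1) : 'I_k.+1 := inord (k %/ d).
have hE (d : 'I_k.+1) : h d = k %/ d :> nat by rewrite inordK // ltnS leq_div.
have codvdK (d : nat) : d %| k -> k %/ (k %/ d) = d.
  move=> dvd_dk; rewrite -{1}(divnK dvd_dk) mulKn // divn_gt0 ?(dvdn_gt0 k_gt0) //.
  exact: dvdn_leq.
rewrite [RHS](reindex_onto h h) => [|d dvd_dk]; last by apply: val_inj; rewrite /= !hE codvdK.
apply: eq_big => [d|d _]; last by rewrite hE.
rewrite -(inj_eq val_inj) /= !hE; apply/idP/andP => [dvd_dk | [dvd_h /eqP <-]].
  by rewrite codvdK // eqxx dvdn_div.
exact: dvdn_div.
Qed.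

(* Expand k = \sum_(d | k) phi(k / d), keep the terms d <= y and use phi(k) <= d * phi(k / d). *)
Lemma totient_harmonic_le (y k : nat) : 0 < k -> y`! %| k ->
  totient k * (\sum_(1 <= d < y.+1) y`! %/ d) <= k * y`!.
Proof.
move=> k_gt0 dvd_k; have le_yk : y <= k by rewrite (leq_trans (fact_geq y)) // dvdn_leq.
apply: (@leq_trans ((\sum_(1 <= d < y.+1) totient (k %/ d)) * y`!)).
  rewrite big_distrr big_distrl /=; rewrite big_nat [leqRHS]big_nat.
  apply: leq_sum => d /andP[d_gt0 le_dy]; have dvd_d : d %| y`! by rewrite dvdn_fact ?d_gt0.
  rewrite -[X in _ <= _ * X](divnK dvd_d) mulnCA mulnC leq_mul2l mulnC; apply/orP; right.
  by rewrite -{1}(divnK (dvdn_trans dvd_d dvd_k)) mulnC leq_totient_mull.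
rewrite leq_mul2r -{2}(sum_totient_codvd k_gt0); apply/orP; right.
(* Each positive d <= y divides y!, hence k, so these terms are among those of the full divisor
   sum. *)
rewrite (@big_nat_widen _ _ _ _ _ k.+1) // (@big_nat_widenl _ _ _ _ 0) // big_mkord.
rewrite big_mkcond [leqRHS]big_mkcond /=; apply: leq_sum => d _.
case: ifP => // /andP[le_dy d_gt0].
by rewrite (dvdn_trans _ dvd_k) // dvdn_fact ?d_gt0.
Qed.

Lemma exists_pred_exp_smooth (b n M y : nat) : 1 < b -> 1 < M -> 0 < y -> y`! <= M ->
  b.+1 ^ (4 * M) <= n ->
  exists k, [/\ 0 < k, M * (\sum_(1 <= d < y.+1) y`! %/ d) <= 2 * k * y`!
    & forall p, prime p -> p ^ logn p (b ^ k).-1 <= n].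
Proof.
move=> b_gt1 M_gt1 y_gt0 le_yM le_n.
have := fact_gt0 y; have := fact_geq y; have := @totient_harmonic_le y.
set A := (\sum_(_ <= _ < _) _)%N; set F := y`! in le_yM * => totA le_yF F_gt0.
have le_FA : F <= A by rewrite /A big_nat_recl // divn1 leq_addr.
have le_AyF : A <= y * F.
  apply: (@leq_trans (\sum_(1 <= d < y.+1) F)); first by apply: leq_sum => d _; apply: leq_div.
  by rewrite sum_nat_const_nat subn1.
(* [A / F] is the harmonic number H_y, and [k] is the largest multiple of y! not exceeding M H_y.
   This gives phi(k) <= k / H_y <= M. *)
pose t := M * A %/ F ^ 2; pose k := F * t.
have F2_gt0 : 0 < F ^ 2 by rewrite expn_gt0 F_gt0.
have t_gt0 : 0 < t by rewrite divn_gt0 // -mulnn leq_mul.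
have tF : t * F ^ 2 <= M * A by exact: leq_trunc_div.
have Ft : M * A < t.+1 * F ^ 2 by exact: ltn_ceil.
have k_gt0 : 0 < k by rewrite muln_gt0 F_gt0.
have tot_k : totient k <= M.
  rewrite -(@leq_pmul2r A) ?(leq_trans F_gt0) //.
  apply: leq_trans (totA k k_gt0 (dvdn_mulr _ _)) _ => //.
  by rewrite /k; move: tF; rewrite -mulnn; lia.
(* Here H_y <= y <= y! <= M. *)
have le_kM : k <= M * M.
  rewrite -(@leq_pmul2r F) //; apply: (@leq_trans (M * A)).
    by rewrite /k; move: tF; rewrite -mulnn; lia.
  by rewrite -mulnA leq_mul // (leq_trans le_AyF) // leq_mul // (leq_trans le_yF).
exists k; split=> // [|p p_pr].
  (* Rounding down costs at most a factor 2, because t >= 1 gives t + 1 <= 2t. *)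
  have -> : 2 * k * F = 2 * t * F ^ 2 by rewrite /k -mulnn; lia.
  by rewrite (leq_trans (ltnW Ft)) // leq_mul2r; apply/orP; right; lia.
apply: leq_trans (pfactor_pred_exp_le p_pr b_gt1 k_gt0) _; apply: leq_trans le_n.
have M_le : M <= b.+1 ^ M by rewrite ltnW // ltn_expl // ltnS ltnW.
(* Combine phi(k) <= M with k <= M^2 <= (b+1)^(2M); the total exponent 3M + 2 is at most 4M as M >=
   2. *)
apply: (@leq_trans (b.+1 ^ (M + 2) * (b.+1 ^ M * b.+1 ^ M))).
  by rewrite leq_mul // ?leq_pexp2l ?leq_add2r // (leq_trans le_kM) // leq_mul.
by rewrite -!expnD leq_pexp2l //; lia.
Qed.

(** * Translation to divisibility of lcm(1..n) by b^k - 1 *)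

Lemma factE (n : nat) : fact n = n`!.
Proof. by elim: n => // n IHn; rewrite factS -IHn. Qed.

Lemma fact_harmonicE (y : nat) : fact_harmonic y = \sum_(1 <= d < y.+1) y`! %/ d.
Proof.
elim: y => [|y IHy]; first by rewrite big_geq.
rewrite big_nat_recr //= factS mulKn // -[LHS]/(y.+1 * fact_harmonic y + fact y)%N.
rewrite IHy factE big_distrr /=; congr (_ + _); rewrite big_nat [RHS]big_nat.
by apply: eq_bigr => d d_le; rewrite muln_divA // dvdn_fact.
Qed.

Lemma powE (m n : nat) : Nat.pow m n = m ^ n.
Proof. by elim: n => //= n ->; rewrite expnS. Qed.

(** Divisibility can be tested on the prime-power parts of b^k - 1, and each part, being at most n,
    divides lcm(1..n). *)
Lemma exists_pred_pow_divide_lcm_upto (b n M y : nat) :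
  (2 <= b)%coq_nat -> (2 <= M)%coq_nat -> (1 <= y)%coq_nat -> (fact y <= M)%coq_nat ->
  (Nat.pow (S b) (4 * M) <= n)%coq_nat ->
  exists k, (Nat.mul M (fact_harmonic y) <= Nat.mul (Nat.mul 2 k) (fact y))%coq_nat /\
    Nat.divide (Nat.sub (Nat.pow b k) 1) (lcm_upto n).
Proof.
rewrite powE !factE fact_harmonicE => /leP b_gt1 /leP M_gt1 /leP y_gt0 /leP le_yM /leP le_n.
have [k [k_gt0 le_k smooth]] := exists_pred_exp_smooth b_gt1 M_gt1 y_gt0 le_yM le_n.
exists k; split; first by apply/leP; rewrite multE.
have bk_gt0 : 0 < (b ^ k).-1 by rewrite -subn1 subn_gt0 -(exp1n k) ltn_exp2r.
suff /dvdnP[q ->] : (b ^ k).-1 %| lcm_upto n by exists q; rewrite powE -subn1.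
apply/dvdn_partP => // p; rewrite mem_primes => /andP[p_pr _]; rewrite p_part.
have [|q ->] := divide_lcm_upto (p ^ logn p (b ^ k).-1) n; last exact: dvdn_mull.
by split; apply/leP; [rewrite expn_gt0 prime_gt0 | exact: smooth].
Qed.

End Smooth.

Open Scope R_scope.

(** * Logarithmic estimates for harmonic numbers and factorials *)

(** This is H_y >= ln(y+1) scaled by y!; the induction step is ln(y+2) - ln(y+1) <= 1/(y+1). *)
Lemma ln_succ_le_harmonic (y : nat) : ln (INR (S y)) * INR (fact y) <= INR (fact_harmonic y).
Proof.
  induction y as [|y IH].
  - cbn. rewrite ln_1. lra.
  - change (fact (S y)) with (S y * fact y)%nat. cbn [fact_harmonic].
    rewrite plus_INR, !mult_INR.
    assert (hy : 0 < INR (S y)) by (apply lt_0_INR; lia).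
    assert (hf : 0 < INR (fact y)) by (apply lt_0_INR, lt_O_fact).
    assert (hln : INR (S y) * (ln (INR (S (S y))) - ln (INR (S y))) <= 1).
    { replace (INR (S (S y))) with (INR (S y) * (1 + / INR (S y)))
        by (rewrite (S_INR (S y)); field; lra).
      assert (0 < / INR (S y)) by now apply Rinv_0_lt_compat.
      assert (ln (1 + / INR (S y)) <= / INR (S y)).
      { rewrite <- (ln_exp (/ INR (S y))) at 2. apply Rlt_le, ln_increasing; [lra|].
        apply exp_ineq1. lra. }
      rewrite ln_mult by lra.
      apply Rmult_le_reg_l with (/ INR (S y)); [assumption|].
      rewrite <- Rmult_assoc, Rinv_l by lra. lra. }
    nra.
Qed.

Lemma exists_bracket (f : nat -> nat) (x N : nat) : (f 0 <= x)%nat -> (x < f N)%nat ->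
  exists y, (f y <= x < f (S y))%nat.
Proof.
  intros h0. induction N as [|N IH]; intros hN; [lia|].
  destruct (Nat.le_gt_cases (f N) x); [exists N; lia|now apply IH].
Qed.

Lemma fact_le_pow (y : nat) : (fact y <= y ^ y)%nat.
Proof.
  induction y as [|y IH]; [exact (Nat.le_refl _)|].
  change (fact (S y)) with (S y * fact y)%nat. rewrite Nat.pow_succ_r'.
  apply Nat.mul_le_mono_l. apply Nat.le_trans with (1 := IH). apply Nat.pow_le_mono_l. lia.
Qed.

(** From M < (y+1)^(y+1) one gets ln M < (y+1) ln(y+1) < (y+1)^2. *)
Lemma lnln_le_of_lt_fact (M y : nat) : (2 <= M)%nat -> (M < fact (S y))%nat ->
  ln (ln (INR M)) <= 2 * ln (INR (S y)).
Proof.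
  intros hM hlt.
  assert (hy : 0 < INR (S y)) by (apply lt_0_INR; lia).
  assert (hM' : 2 <= INR M) by (apply (le_INR 2); assumption).
  assert (hlnM : 0 < ln (INR M)) by (rewrite <- ln_1; apply ln_increasing; lra).
  assert (hlt' : ln (INR M) < INR (S y) * ln (INR (S y))).
  { rewrite <- ln_pow by assumption. apply ln_increasing; [lra|].
    rewrite <- pow_INR. apply lt_INR. pose proof (fact_le_pow (S y)). lia. }
  assert (hly : ln (INR (S y)) < INR (S y)).
  { rewrite <- (ln_exp (INR (S y))) at 2. apply ln_increasing; [assumption|].
    pose proof (exp_ineq1 (INR (S y))). lra. }
  replace (2 * ln (INR (S y))) with (ln (INR (S y) * INR (S y))) by (rewrite ln_mult by lra; ring).
  apply Rlt_le, ln_increasing; nra.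
Qed.

Lemma digit_sum_pos (b m : nat) : (2 <= b)%nat -> (0 < m)%nat -> (1 <= digit_sum b m)%nat.
Proof.
  intros hb. induction m as [m IH] using lt_wf_ind. intros hm.
  rewrite digit_sum_step by lia.
  assert (m / b < m)%nat by (apply Nat.div_lt; lia).
  pose proof (Nat.div_mod_eq m b).
  destruct (Nat.eq_dec (m / b) 0); [nia|].
  specialize (IH (m / b)%nat ltac:(lia) ltac:(lia)). lia.
Qed.

(** * Digit sums of multiples of lcm(1..n) *)

Lemma digit_sum_multiple_lcm_upto_ge (b n M m : nat) :
  (2 <= b)%nat -> (2 <= M)%nat -> (S b ^ (4 * M) <= n)%nat -> (0 < m)%nat ->
  Nat.divide (lcm_upto n) m ->
  INR M * ln (ln (INR M)) <= 4 * INR (digit_sum b m).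
Proof.
  intros hb hM hn hm hdvd.
  (* The shift to [S y] makes the factorial parameter positive: (y+1)! <= M < (y+2)!. *)
  destruct (exists_bracket (fun y => fact (S y)) M M) as [y [hy1 hy2]].
  { cbn. lia. }
  { change (fact (S M)) with (S M * fact M)%nat. pose proof (lt_O_fact M). nia. }
  destruct (@Smooth.exists_pred_pow_divide_lcm_upto b n M (S y) hb hM ltac:(lia) hy1 hn)
    as [k [hk hkdvd]].
  pose proof (le_INR _ _ (digit_sum_ge_of_dvd b k m hb hm (Nat.divide_trans _ _ _ hkdvd hdvd))).
  pose proof (lnln_le_of_lt_fact M (S y) hM hy2).
  pose proof (ln_succ_le_harmonic (S y)) as hharm.
  apply le_INR in hk. rewrite !mult_INR in hk. replace (INR 2) with 2 in hk by reflexivity.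
  assert (hf : 0 < INR (fact (S y))) by (apply lt_0_INR, lt_O_fact).
  assert (hM0 : 0 < INR M) by (apply lt_0_INR; lia).
  assert (INR M * ln (INR (S (S y))) <= 2 * INR k).
  { apply Rmult_le_reg_r with (INR (fact (S y))); nra. }
  nra.
Qed.

Lemma ln_le (x y : R) : 0 < x -> x <= y -> ln x <= ln y.
Proof. intros hx [hxy| ->]; [now apply Rlt_le, ln_increasing|apply Rle_refl]. Qed.

Lemma ln_le_self (x : R) : 0 <= x -> ln x <= x.
Proof.
  intros [hx| <-].
  - rewrite <- (ln_exp x) at 2. apply Rlt_le, ln_increasing; [assumption|].
    pose proof (exp_ineq1 x). lra.
  (* [ln] takes the default value 0 at 0. *)
  - unfold ln. destruct (Rlt_dec 0 0) as [h|h]; [now destruct (Rlt_irrefl 0)|apply Rle_refl].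
Qed.

Lemma one_le_ln (n : nat) : (3 <= n)%nat -> 1 <= ln (INR n).
Proof.
  intros hn. apply (le_INR 3) in hn. replace (INR 3) with 3 in hn by (cbn; ring).
  pose proof exp_le_3. pose proof (exp_pos 1).
  rewrite <- (ln_exp 1). apply ln_le; lra.
Qed.

(** Take M maximal with (b+1)^(4M) <= n, so that L = ln n < 8 M beta. In the threshold, 256 beta^2
    forces M^2 > L and exp 4 forces ln L >= 4, which together give ln ln M >= (ln ln L) / 2. *)
Lemma digit_sum_multiple_lcm_upto_large (b n m : nat) :
  (2 <= b)%nat -> (0 < m)%nat -> (3 <= n)%nat -> Nat.divide (lcm_upto n) m ->
  256 * ln (INR (S b)) ^ 2 + exp 4 <= ln (INR n) ->
  ln (INR n) * ln (ln (ln (INR n))) <= 64 * ln (INR (S b)) * INR (digit_sum b m) /\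
  0 < ln (ln (ln (INR n))).
Proof.
  intros hb hm hn hdvd hlarge.
  pose proof (one_le_ln (S b) ltac:(lia)) as hbeta.
  set (beta := ln (INR (S b))) in *. set (L := ln (INR n)) in *.
  assert (hD : (1 < S b ^ 4)%nat) by (apply Nat.pow_gt_1; lia).
  destruct (exists_bracket (fun M => ((S b ^ 4) ^ M)%nat) n n) as [M [hM1 hM2]].
  { rewrite Nat.pow_0_r. lia. }
  { now apply Nat.pow_gt_lin_r. }
  rewrite <- Nat.pow_mul_r in hM1, hM2.
  assert (hb0 : 0 < INR (S b)) by (apply lt_0_INR; lia).
  assert (hn0 : 0 < INR n) by (apply lt_0_INR; lia).
  assert (hLM : L < 4 * (INR M + 1) * beta).
  { apply lt_INR in hM2. rewrite pow_INR in hM2. apply ln_increasing in hM2; [|assumption].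
    rewrite ln_pow, mult_INR, (S_INR M) in hM2 by assumption.
    replace (INR 4) with 4 in hM2 by (cbn; ring). unfold L, beta. lra. }
  pose proof (exp_pos 4) as he4.
  assert (hM63 : 63 < INR M) by nra.
  assert (hMge : (2 <= M)%nat).
  { apply INR_le. replace (INR 2) with 2 by reflexivity. lra. }
  pose proof (digit_sum_multiple_lcm_upto_ge b n M m hb hMge hM1 hm hdvd) as hmain.
  assert (hL8 : L < 8 * INR M * beta) by nra.
  assert (hLMM : L < INR M * INR M).
  { assert (L * (256 * beta ^ 2) <= L * L) by nra.
    assert (L * L < (8 * INR M * beta) * (8 * INR M * beta)) by nra.
    assert (0 < beta ^ 2) by nra.
    apply Rmult_lt_reg_r with (256 * beta ^ 2); nra. }
  assert (hl : 4 <= ln L).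
  { rewrite <- (ln_exp 4). apply ln_le; [assumption|nra]. }
  assert (hlM : ln L / 2 <= ln (INR M)).
  { assert (ln L <= ln (INR M * INR M)) by (apply ln_le; nra).
    rewrite ln_mult in H by lra. lra. }
  assert (hll : 0 < ln (ln L)) by (rewrite <- ln_1; apply ln_increasing; lra).
  assert (hllM : ln (ln L) / 2 <= ln (ln (INR M))).
  { assert (ln (ln L / 2) <= ln (ln (INR M))) by (apply ln_le; lra).
    (* For v = ln L >= 4 one has v <= (v/2)^2. *)
    assert (ln (ln L) <= ln (ln L / 2 * (ln L / 2))) by (apply ln_le; nra).
    rewrite ln_mult in H0 by lra. lra. }
  split; [|assumption].
  assert (INR M * (ln (ln L) / 2) <= 4 * INR (digit_sum b m)) by nra.
  assert (L * ln (ln L) <= 8 * INR M * beta * ln (ln L)) by nra.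
  nra.
Qed.

Lemma digit_sum_multiple_lcm_upto_gt (b : nat) : (2 <= b)%nat ->
  exists C : R, 0 < C /\ forall n m : nat, (3 <= n)%nat -> (0 < m)%nat ->
    Nat.divide (lcm_upto n) m ->
    INR (digit_sum b m) > C * ln (INR n) * ln (ln (ln (INR n))).
Proof.
  intros hb. pose proof (one_le_ln (S b) ltac:(lia)) as hbeta.
  set (beta := ln (INR (S b))) in *. set (T := 256 * beta ^ 2 + exp 4).
  pose proof (exp_pos 4) as he4.
  assert (hT : 1 <= T) by (unfold T; nra).
  assert (hD : 0 < 128 * beta * T ^ 2) by (apply Rmult_lt_0_compat; nra).
  (* Doubling 64 to 128 makes the inequality strict for ln n >= T; the factor T^2 covers ln n < T,
     where the digit sum is at least 1 and L ln ln L <= L^2 <= T^2. *)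
  exists (/ (128 * beta * T ^ 2)). split; [now apply Rinv_0_lt_compat|].
  intros n m hn hm hdvd. apply Rlt_gt.
  apply Rmult_lt_reg_l with (128 * beta * T ^ 2); [assumption|].
  rewrite <- !Rmult_assoc, Rinv_r, Rmult_1_l by lra.
  pose proof (one_le_ln n hn) as hL.
  assert (hs : 1 <= INR (digit_sum b m)) by (apply (le_INR 1), digit_sum_pos; assumption).
  set (s := INR (digit_sum b m)) in *.
  destruct (Rle_lt_dec T (ln (INR n))) as [hlarge|hsmall].
  - destruct (digit_sum_multiple_lcm_upto_large b n m hb hm hn hdvd hlarge) as [h1 h2].
    fold beta s in h1.
    assert (0 < beta * s) by (apply Rmult_lt_0_compat; lra).
    assert (1 <= T ^ 2) by nra.
    assert (beta * s * 1 <= beta * s * T ^ 2) by (apply Rmult_le_compat_l; lra). lra.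
  - set (L := ln (INR n)) in *.
    assert (hl0 : 0 <= ln L) by (rewrite <- ln_1; apply ln_le; lra).
    pose proof (ln_le_self (ln L) hl0). pose proof (ln_le_self L ltac:(lra)).
    assert (L * ln (ln L) <= T ^ 2) by nra.
    assert (0 < T ^ 2) by nra.
    assert (1 <= beta * s) by nra.
    nra.
Qed.

Theorem theorem1 (b : nat) (hb : (2 <= b)%nat) :
  exists C : R, 0 < C /\
    forall n : nat, (3 <= n)%nat ->
      INR (digit_sum b (fact n)) > C * ln (INR n) * ln (ln (ln (INR n))) /\
      INR (digit_sum b (lcm_upto n)) > C * ln (INR n) * ln (ln (ln (INR n))).
Proof.
  destruct (digit_sum_multiple_lcm_upto_gt b hb) as [C [hC hgt]].
  exists C. split; [assumption|]. intros n hn.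
  split; apply hgt; try assumption.
  - apply lt_O_fact.
  - apply lcm_upto_divide_fact.
  - apply lcm_upto_pos.
  - apply Nat.divide_refl.
Qed.
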